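(* Let $n,m,u,v,d$ be nonnegative integers with $d\ge1$ and $u+v<m-1$, and put $M=m-(u+v+2)$. Let $\mathbf{p}_0,\dots,\mathbf{p}_n\in\mathbb{R}^d$, $\omega_0,\dots,\omega_n>0$, $\mathbf{P}_i=\omega_i\mathbf{p}_i$, $\omega(t)=\sum_{i=0}^n\omega_iB_i^n(t)$ and $\mathbf{x}(t)=\frac{1}{\omega(t)}\sum_{i=0}^n\mathbf{P}_iB_i^n(t)$ for $t\in[0,1]$. For $\tilde{\mathbf{q}}_0,\dots,\tilde{\mathbf{q}}_M\in\mathbb{R}^d$ let $$\tilde{\mathbf{y}}(t)=\sum_{i=0}^u\mathbf{q}_iB_i^m(t)+t^{u+1}(1-t)^{v+1}\sum_{j=0}^{M}\tilde{\mathbf{q}}_jJ_j^{(u+1,v+1)}(2t-1)+\sum_{i=m-v}^m\mathbf{q}_iB_i^m(t),$$ where the points $\mathbf{q}_i\in\mathbb{R}^d$ ($0\le i\le u$ or $m-v\le i\le m$) are fixed so that $\mathbf{x}$ and $\tilde{\mathbf{y}}$ satisfy $C^{(u,v)}$-continuity. Consider the problem of minimizing, over $\tilde{\mathbf{q}}_0,\dots,\tilde{\mathbf{q}}_M\in\mathbb{R}^d$, $$\int_0^1\rho(t)\,\|\mathbf{x}(t)-\tilde{\mathbf{y}}(t)\|^2\,dt,\qquad \rho(t)=\frac{\omega(t)}{t^{u+1}(1-t)^{v+1}},$$ with $\|\cdot\|$ the Euclidean norm. Then the minimizer $(\tilde{\mathbf{q}}_0,\dots,\tilde{\mathbf{q}}_M)$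 is the unique solution of the linear system, for $k=0,\dots,M$, $$\sum_{j=0}^{M}\left(\sum_{i=0}^{n+k}\sum_{l=0}^{j}\frac{(-1)^{j+l}\binom{n+k}{i}\binom{j+u+1}{l}\binom{j+v+1}{j-l}}{(u+v+n+k+j+3)\binom{u+v+n+k+j+2}{u+l+i+1}}\,D_i^{(k)}\right)\tilde{\mathbf{q}}_j$$ $$=\frac{1}{n+k+1}\sum_{i=0}^{n+k}\ \sum_{j=\max(0,i-n)}^{\min(k,i)}\frac{\binom{k}{j}\binom{n}{i-j}}{\binom{n+k}{i}}A_j^{(k)}\mathbf{P}_{i-j}\;-\;\frac{1}{m+n+k+1}\sum_{i=0}^{m+n+k}\ \sum_{j=\max(0,i-m-n)}^{\min(k,i)}\frac{\binom{k}{j}\binom{m+n}{i-j}}{\binom{m+n+k}{i}}A_j^{(k)}\mathbf{C}_{i-j},$$ where $$A_i^{(k)}=(-1)^{k+i}\frac{\binom{k+u+1}{i}\binom{k+v+1}{k-i}}{\binom{k}{i}},\qquad D_i^{(k)}=\sum_{j=\max(0,i-n)}^{\min(k,i)}\frac{\binom{k}{j}\binom{n}{i-j}}{\binom{n+k}{i}}\,\omega_{i-j}A_j^{(k)},$$ $$\mathbf{C}_i=\sum_{j=\max(0,i-n)}^{\min(m,i)}\frac{\binom{m}{j}\binom{n}{i-j}}{\binom{m+n}{i}}\,\omega_{i-j}\mathbf{Q}_j,$$ and $\mathbf{Q}_j=\mathbf{q}_j$ if $0\le j\le u$ or $m-v\le j\le m$, and $\mathbf{Q}_j=\mathbf{0}$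 otherwise.
   Context: $B_i^n(t)=\binom{n}{i}t^i(1-t)^{n-i}$ are the Bernstein basis functions. $J_k^{(a,b)}$ denotes the Jacobi polynomial of degree $k$; explicitly, $J_k^{(u+1,v+1)}(2t-1)=\sum_{i=0}^kA_i^{(k)}B_i^k(t)$ with $A_i^{(k)}$ as given in the claim. $C^{(u,v)}$-continuity of $\mathbf{x}$ and $\tilde{\mathbf{y}}$ means that $\mathbf{x}^{(r)}(0)=\tilde{\mathbf{y}}^{(r)}(0)$ for $r=0,\dots,u$ and $\mathbf{x}^{(s)}(1)=\tilde{\mathbf{y}}^{(s)}(1)$ for $s=0,\dots,v$; this condition depends only on the points $\mathbf{q}_i$ and not on the $\tilde{\mathbf{q}}_j$. *)

(* Defs.v *)
From mathcomp Require Import all_boot all_order all_algebra.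
From mathcomp Require Import all_classical all_reals all_analysis.
From mathcomp Require Import ring.
Import Order.TTheory GRing.Theory Num.Theory.
Import numFieldNormedType.Exports.

Set Implicit Arguments.
Unset Strict Implicit.
Unset Printing Implicit Defensive.

Local Open Scope ring_scope.

(* Finite families given on an initial segment of the integers (weights, control
   points) are functions on nat, of which only the values at the indices in range
   are ever used.  Truncated subtraction gives max(0, i - n) = (i - n)%N. *)

(* The norm `|_| of the library on row vectors is the sup norm. *)
Definition enorm (R : realType) (d : nat) (w : 'rV[R]_d) : R :=
  Num.sqrt (\sum_(i < d) w ord0 i ^+ 2).

Definition bernstein (R : realType) (n i : nat) (t : R) : R :=
  'C(n, i)%:R * t ^+ i * (1 - t) ^+ (n - i).

(* Jacobi polynomial of degree k for integer parameters a, b, normalised by the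
   value 'C(k + a, k) at 1. *)
Definition jacobi (R : realType) (a b k : nat) (x : R) : R :=
  \sum_(s < k.+1) 'C(k + a, k - s)%:R * 'C(k + b, s)%:R
                  * ((x - 1) / 2) ^+ s * ((x + 1) / 2) ^+ (k - s).

Section RationalCurve.
Variables (R : realType) (d n : nat) (omega : nat -> R) (p : nat -> 'rV[R]_d).

Definition weight (t : R) : R := \sum_(i < n.+1) omega i * bernstein n i t.

Definition rat_curve (t : R) : 'rV[R]_d :=
  (weight t)^-1 *: \sum_(i < n.+1) bernstein n i t *: (omega i *: p i).

End RationalCurve.

Section PolynomialCurve.
Variables (R : realType) (d m u v M : nat).
Variables (q : nat -> 'rV[R]_d) (qt : 'I_M.+1 -> 'rV[R]_d).

Definition poly_curve (t : R) : 'rV[R]_d :=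
  \sum_(0 <= i < u.+1) bernstein m i t *: q i
  + (t ^+ u.+1 * (1 - t) ^+ v.+1)
      *: (\sum_(j < M.+1) jacobi u.+1 v.+1 j (2 * t - 1) *: qt j)
  + \sum_(m - v <= i < m.+1) bernstein m i t *: q i.

End PolynomialCurve.

(* The curves compared below are given by formulas that make sense, and are
   smooth, on a neighbourhood of 0 and of 1, where the two-sided derivatives
   agree with the one-sided derivatives of the restrictions to [0, 1]. *)
Definition Cuv_continuity (R : realType) (d u v : nat) (f g : R -> 'rV[R]_d) :
    Prop :=
  (forall r : nat, (r <= u)%N -> derive1n r f 0 = derive1n r g 0) /\
  (forall s : nat, (s <= v)%N -> derive1n s f 1 = derive1n s g 1).

(* The integrand is nonnegative, so the integral always makes sense in \bar R;
   the value of the weight at the endpoints 0 and 1 (a division by zero) is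
   irrelevant. *)
Definition weighted_error (R : realType) (d n m u v M : nat)
    (omega : nat -> R) (p q : nat -> 'rV[R]_d) (qt : 'I_M.+1 -> 'rV[R]_d) :
    \bar R :=
  \int[@lebesgue_measure R]_(t in `[0%R, 1%R]%classic)
    (weight n omega t / (t ^+ u.+1 * (1 - t) ^+ v.+1)
     * enorm (rat_curve n omega p t - poly_curve m u v q qt t) ^+ 2)%:E.

Section Coefficients.
Variables (R : realType) (u v : nat).

Definition Acoef (k i : nat) : R :=
  (-1) ^+ (k + i) * ('C(k + u + 1, i)%:R * 'C(k + v + 1, k - i)%:R)
  / 'C(k, i)%:R.

Definition Dcoef (n : nat) (omega : nat -> R) (k i : nat) : R :=
  \sum_(i - n <= j < (minn k i).+1)
    ('C(k, j)%:R * 'C(n, i - j)%:R / 'C(n + k, i)%:R)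
    * omega (i - j)%N * Acoef k j.

Definition Qpoint (d m : nat) (q : nat -> 'rV[R]_d) (j : nat) : 'rV[R]_d :=
  if (j <= u)%N || (m - v <= j <= m)%N then q j else 0.

Definition Cpoint (d n m : nat) (omega : nat -> R) (q : nat -> 'rV[R]_d)
    (i : nat) : 'rV[R]_d :=
  \sum_(i - n <= j < (minn m i).+1)
    ('C(m, j)%:R * 'C(n, i - j)%:R / 'C(m + n, i)%:R * omega (i - j)%N)
    *: Qpoint m q j.

End Coefficients.

Lemma jacobi_bernstein (R : realType) (u v k : nat) (t : R) :
  jacobi u.+1 v.+1 k (2 * t - 1)
  = \sum_(i < k.+1) Acoef R u v k i * bernstein k i t.
Proof.
rewrite /jacobi (reindex_inj rev_ord_inj) /=; apply: eq_bigr => i _.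
have ik : (i <= k)%N by rewrite -ltnS.
rewrite /Acoef /bernstein subSS subKn // !addn1 !addnS.
have -> : (2 * t - 1 - 1) / 2 = - (1 - t) by field.
have -> : (2 * t - 1 + 1) / 2 = t by field.
have C0 : 'C(k, i)%:R != 0 :> R by rewrite pnatr_eq0 -lt0n bin_gt0.
have -> : (-1) ^+ (k + i) = (-1) ^+ (k - i) :> R.
  by rewrite -signr_odd oddD -(oddB ik) signr_odd.
rewrite (exprNn (1 - t)); field; exact: C0.
Qed.

(* Main.v *)
Require Import Defs.
From HB Require Import structures.
From mathcomp Require Import all_boot all_order all_algebra.
From mathcomp Require Import all_classical all_reals all_analysis.
From mathcomp Require Import ring lra zify.
Import Order.TTheory GRing.Theory Num.Theory.
Import numFieldNormedType.Exports.

Set Implicit Arguments.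
Unset Strict Implicit.
Unset Printing Implicit Defensive.

Local Open Scope ring_scope.

(* Multiplying the continuity conditions by the weight [omega] shows that the
   polynomial curve [omega (x - y)] vanishes to order [u + 1] at 0 and [v + 1]
   at 1, so that [sum_i P_i B_i^n - omega y_0 = w g] with
   [w = t^(u+1) (1-t)^(v+1)], [y_0] the fixed part of [y~] and [g] polynomial.
   With [S = sum_j q~_j J_j] the integrand becomes
     [(w / omega) |g - omega S|^2 = w |g|^2 / omega + w (omega |S|^2 - 2 <g, S>)],
   whose first summand does not depend on the unknowns and whose second summand
   is a polynomial: a least-squares problem for the positive definite form
   [int_0^1 w omega P Q] on polynomials of degree at most [M].  Its normal
   equations [int w J_k (omega S - g) = 0] are the linear system, once products
   of Bernstein expansions and beta integrals are written out. *)

(** * Integration of polynomials over [[0, 1]] *)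

Section PolyIntegral.
Variable R : realType.
Implicit Types (p q : {poly R}) (t : R).

(** The antiderivative that vanishes at 0: its constant coefficient is a quotient by [0%:R], hence 0
    since the inverse of 0 is 0. *)
Definition poly_prim p : {poly R} :=
  \poly_(i < (size p).+1) (p`_i.-1 / i%:R).

Lemma coef_poly_prim p i : (poly_prim p)`_i = p`_i.-1 / i%:R.
Proof.
rewrite coef_poly; case: ltnP => // hi.
by rewrite nth_default ?mul0r // -ltnS prednK // (leq_trans _ hi).
Qed.

Lemma deriv_poly_prim p : (poly_prim p)^`() = p.
Proof.
apply/polyP => i; rewrite coef_deriv coef_poly_prim /= -[LHS]mulr_natr divfK //.
Qed.

Lemma poly_prim_horner0 p : (poly_prim p).[0] = 0.
Proof. by rewrite horner_coef0 coef_poly_prim invr0 mulr0. Qed.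

(** An algebraic form of the integral over the unit interval, so that linearity and beta integrals
    are computations on coefficients; [integral_poly] ties it to the Lebesgue integral. *)
Definition poly_int p : R := (poly_prim p).[1].

Lemma poly_int_is_linear : linear poly_int.
Proof.
move=> a p q; rewrite /poly_int.
suff -> : poly_prim (a *: p + q) = a *: poly_prim p + poly_prim q.
  by rewrite hornerD hornerZ.
by apply/polyP => i; rewrite coefD coefZ !coef_poly_prim coefD coefZ mulrDl mulrA.
Qed.

HB.instance Definition _ :=
  GRing.isLinear.Build R {poly R} R _ poly_int poly_int_is_linear.

Lemma poly_intZ a p : poly_int (a *: p) = a * poly_int p.
Proof. exact: linearZ. Qed.

Lemma poly_int_deriv p : poly_int p^`() = p.[1] - p.[0].
Proof.
rewrite -[p.[0]](hornerC _ 1) -hornerN -hornerD /poly_int; congr horner.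
apply/polyP => -[|i]; rewrite coef_poly_prim coefB coefC /=.
  by rewrite invr0 mulr0 horner_coef0 subrr.
by rewrite coef_deriv subr0 -[_ *+ _]mulr_natr mulfK // pnatr_eq0.
Qed.

Lemma integral_poly p :
  (\int[@lebesgue_measure R]_(t in `[0%R, 1%R]%classic) (p.[t])%:E
   = (poly_int p)%:E)%E.
Proof.
rewrite (@continuous_FTC2 _ (horner p) (horner (poly_prim p))) //.
- by rewrite poly_prim_horner0 sube0.
- by apply: continuous_subspaceT; exact: continuous_horner.
- split.
  + by move=> x _; have := is_derive_poly (poly_prim p) x; case.
  + by apply: cvg_at_right_filter; exact: continuous_horner.
  + by apply: cvg_at_left_filter; exact: continuous_horner.
- move=> x _; rewrite derive1E; have := is_derive_poly (poly_prim p) x.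
  by case=> _ ->; rewrite deriv_poly_prim.
Qed.

Lemma poly_eq0_unit_interval p :
  (forall t, 0 <= t <= 1 -> p.[t] = 0) -> p = 0.
Proof.
move=> p0; apply/eqP/negPn/negP => pn0.
(* These are [size p] distinct points of the interval, more roots than a nonzero [p] can have. *)
pose s := [seq (i%:R / (size p)%:R : R) | i <- iota 0 (size p)].
have sp0 : (0 < (size p)%:R :> R) by rewrite ltr0n lt0n size_poly_eq0.
suff [rs us] : all (root p) s /\ uniq s.
  by have := max_poly_roots pn0 rs us; rewrite size_map size_iota ltnn.
split.
  apply/allP => x /mapP[i]; rewrite mem_iota /= add0n => hi ->; apply/rootP/p0.
  by rewrite divr_ge0 ?ler0n //= ler_pdivrMr // mul1r ler_nat ltnW.
rewrite map_inj_uniq ?iota_uniq // => i j h; apply/eqP; rewrite -(eqr_nat R).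
by apply/eqP/(mulIf _ h); rewrite invr_neq0 // gt_eqF.
Qed.

Lemma poly_int_ge0 p : (forall t, 0 <= t <= 1 -> 0 <= p.[t]) -> 0 <= poly_int p.
Proof.
move=> p0; rewrite -lee_fin -integral_poly; apply: integral_ge0 => t /=.
by rewrite in_itv /= lee_fin => /p0.
Qed.

(** The primitive of [p] is nondecreasing on the interval and vanishes at both ends, so it is 0
    there, hence 0 as a polynomial, and so is its derivative [p]. *)
Lemma poly_int_eq0 p :
  (forall t, 0 <= t <= 1 -> 0 <= p.[t]) -> poly_int p = 0 -> p = 0.
Proof.
move=> p0 Ip; rewrite -[p]deriv_poly_prim.
suff -> : poly_prim p = 0 by rewrite deriv0.
have P0 := poly_prim_horner0 p.
have nd x y : 0 <= x -> x <= y -> y <= 1 -> (poly_prim p).[x] <= (poly_prim p).[y].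
  apply: ger0_derive1_ndecr => [z _|z|].
  - by case: (is_derive_poly (poly_prim p) z).
  - rewrite in_itv derive1E => /andP[/ltW z0 /ltW z1].
    by case: (is_derive_poly (poly_prim p) z) => _ ->; rewrite deriv_poly_prim p0 ?z0.
  - by apply: continuous_subspaceT; exact: continuous_horner.
apply: poly_eq0_unit_interval => t /andP[t0 t1]; apply: le_anti.
apply/andP; split; first by rewrite -[leRHS]Ip; exact: nd.
by rewrite -[leLHS]P0; exact: nd.
Qed.

(** The beta integral, by induction on [b] for all [a]: integration by parts trades one factor
    [1 - t] for a factor [t]. *)
Lemma poly_int_beta a b :
  poly_int ('X^a * (1 - 'X) ^+ b) = ((a + b).+1%:R * 'C(a + b, a)%:R)^-1.
Proof.
elim: b a => [|b IH] a.
  have n0 : a.+1%:R != 0 :> R by rewrite pnatr_eq0.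
  have -> : 'X^a * (1 - 'X) ^+ 0 = a.+1%:R^-1 *: ('X^(a.+1))^`() :> {poly R}.
    by rewrite derivXn expr0 mulr1 -[X in _ *: X]scaler_nat scalerA mulVf ?scale1r.
  rewrite poly_intZ poly_int_deriv !hornerXn expr1n expr0n /= subr0 mulr1.
  by rewrite addn0 binn mulr1.
have n1 : b.+1%:R != 0 :> R by rewrite pnatr_eq0.
have n2 : a.+1%:R != 0 :> R by rewrite pnatr_eq0.
have step : a.+1%:R * poly_int ('X^a * (1 - 'X) ^+ b.+1) =
            b.+1%:R * poly_int ('X^(a.+1) * (1 - 'X) ^+ b).
  apply/eqP; rewrite -subr_eq0 -!poly_intZ -linearB /=; apply/eqP.
  (* The difference of the two sides is the integral of the derivative of a polynomial that vanishes
     at 0 and at 1. *)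
  transitivity (poly_int (deriv ('X^(a.+1) * (1 - 'X) ^+ b.+1))).
    have d1 : deriv (1 - 'X : {poly R}) = -1.
      by rewrite derivB derivX -polyC1 derivC sub0r polyC1.
    congr poly_int; rewrite derivM derivXn deriv_exp d1 /=.
    by rewrite -!mul_polyC !polyC_natr; ring.
  by rewrite poly_int_deriv !hornerE subrr !expr0n /= mulr0 mul0r subrr.
apply: (mulfI n2); rewrite step IH addSnnS.
have B0 : 'C((a + b).+1, a)%:R != 0 :> R.
  by rewrite pnatr_eq0 -lt0n bin_gt0 leqW ?leq_addr.
have B1 : 'C((a + b).+1, a.+1)%:R != 0 :> R.
  by rewrite pnatr_eq0 -lt0n bin_gt0 ltnS leq_addr.
have B : a.+1%:R * 'C((a + b).+1, a.+1)%:R = b.+1%:R * 'C((a + b).+1, a)%:R :> R.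
  by rewrite -!natrM mul_bin_left subSn ?leq_addr // addKn.
rewrite addnS !invfM mulrCA [RHS]mulrCA; congr (_ * _).
by apply/eqP; rewrite eqr_div // B.
Qed.

End PolyIntegral.

(** * Order of vanishing of a rational curve *)

Section RationalDerivatives.
Variable R : realType.
Implicit Types (p W F G : {poly R}) (a t : R).

(* Numerator of the r-th derivative of [F / W] over the denominator [W ^+ r.+1]. *)
Fixpoint ratio_deriv W F (r : nat) : {poly R} :=
  if r is s.+1 then
    (ratio_deriv W F s)^`() * W - s.+1%:R *: (ratio_deriv W F s * W^`())
  else F.

Lemma ratio_derivB W F G r :
  ratio_deriv W (F - G) r = ratio_deriv W F r - ratio_deriv W G r.
Proof.
by elim: r => //= r ->; rewrite derivB -!mul_polyC; ring.
Qed.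

Lemma is_derive_ratio p W k t : W.[t] != 0 ->
  is_derive t (1 : R) (fun x => p.[x] / W.[x] ^+ k.+1 : R)
    ((p^`() * W - k.+1%:R *: (p * W^`())).[t] / W.[t] ^+ k.+2).
Proof.
move=> Wt; have Wk : W.[t] ^+ k.+1 != 0 by rewrite expf_neq0.
have Wk' : (W ^+ k.+1).[t] != 0 by rewrite horner_exp.
have dp := is_derive_poly p t; have dW := is_derive_poly (W ^+ k.+1) t.
have dV := @is_deriveV _ _ _ _ _ Wk' dW.
have := is_deriveM dp dV.
have -> : (horner p * (fun x => (W ^+ k.+1).[x]^-1))%R =
          (fun x => p.[x] / W.[x] ^+ k.+1).
  by apply/funext => x; rewrite mulrfctE horner_exp.
move=> H; apply: is_derive_eq H _.
rewrite deriv_exp hornerMn hornerD hornerN hornerZ !hornerM !horner_exp /=.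
rewrite /GRing.scale /= [W.[t] ^+ k.+2]exprS [W.[t] ^+ k.+1]exprS.
rewrite -[_ *+ k.+1]mulr_natl; field.
by rewrite Wt expf_neq0.
Qed.

Lemma derive1n_ratio d W (F : 'I_d -> {poly R}) (f : R -> 'rV[R]_d) :
  (forall t, W.[t] != 0 -> f t = \row_c ((F c).[t] / W.[t])) ->
  forall r t, W.[t] != 0 ->
    derive1n r f t = \row_c ((ratio_deriv W (F c) r).[t] / W.[t] ^+ r.+1).
Proof.
move=> fE; elim=> [|r IH] t Wt; first by rewrite derive1n0 fE.
rewrite derive1nS derive1E.
pose g x : 'rV[R]_d := \row_c ((ratio_deriv W (F c) r).[x] / W.[x] ^+ r.+1).
(* Differentiating once more requires the formula on a neighbourhood of [t]; nonvanishing of [W] is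
   an open condition. *)
have fg : \forall x \near t, derive1n r f x = g x.
  have : \forall x \near t, W.[x] != 0.
    exact: cvgr_neq0 W.[t] (@continuous_horner _ W t) Wt.
  by apply: filterS => x; exact: IH.
have dg c := @is_derive_ratio (ratio_deriv W (F c) r) W r t Wt.
have gE (i : 'I_1) c : (fun x => g x i c) =
    (fun x => (ratio_deriv W (F c) r).[x] / W.[x] ^+ r.+1).
  by apply/funext => x; rewrite mxE.
rewrite (near_eq_derive _ fg) derive_mx; last first.
  by apply/derivable_mxP => i c; rewrite gE; case: (dg c).
by apply/matrixP => i c; rewrite !mxE gE; case: (dg c) => _ ->.
Qed.

(** One step of the recursion lowers the exponent of ['X - a] by one. The terms in which this power
    is not differentiated keep an extra factor ['X - a] and vanish at [a]; the remaining one
    multiplies the cofactor at [a] by the old exponent [k - s] and by [W.[a]]. *)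
Lemma ratio_deriv_root W G a k s : (s <= k)%N ->
  exists2 H, ratio_deriv W (G * ('X - a%:P) ^+ k) s = H * ('X - a%:P) ^+ (k - s)
    & H.[a] = (k ^_ s)%:R * G.[a] * W.[a] ^+ s.
Proof.
elim: s => [|s IH] sk; first by exists G; rewrite ?subn0 // mul1r mulr1.
have [H HE Ha] := IH (ltnW sk).
have kE : (k - s = (k - s.+1).+1)%N by rewrite subnSK.
exists ((H^`() * W - s.+1%:R *: (H * W^`())) * ('X - a%:P) + (k - s)%:R *: (H * W)).
  rewrite /= HE kE; move: (k - s.+1)%N => j.
  rewrite derivM deriv_exp derivXsubC mul1r /= -!mul_polyC !polyC_natr exprS.
  by ring.
rewrite hornerD hornerM hornerXsubC subrr mulr0 add0r hornerZ hornerM Ha ffactnSr.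
by rewrite natrM exprSr; ring.
Qed.

(** If the [k]-th power divides [F] with cofactor [G], the [k]-th numerator takes the value
    [k! G(a) W(a)^k] at [a]; its vanishing makes [a] a root of [G], which raises the exponent by
    one. *)
Lemma ratio_deriv_dvdp W F a u : W.[a] != 0 ->
  (forall r, (r <= u)%N -> (ratio_deriv W F r).[a] = 0) ->
  ('X - a%:P) ^+ u.+1 %| F.
Proof.
move=> Wa F0; suff: forall k, (k <= u.+1)%N -> ('X - a%:P) ^+ k %| F by apply.
elim=> [|k IH] ku; first by rewrite expr0 dvd1p.
have /dvdpP[G FE] := IH (ltnW ku).
have [H HE Ha] := @ratio_deriv_root W G a k k (leqnn k).
have := F0 k ku; rewrite FE HE subnn expr0 mulr1 Ha => /eqP.
rewrite !mulf_eq0 pnatr_eq0 ffactnn eqn0Ngt fact_gt0 /= (negbTE (expf_neq0 _ Wa)) orbF.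
by move=> Ga; rewrite exprS dvdp_mul // dvdp_XsubCl.
Qed.

Lemma endpoint_dvdp (F : {poly R}) u v :
  ('X - 0%:P) ^+ u.+1 %| F -> ('X - 1%:P) ^+ v.+1 %| F ->
  exists g, F = 'X^(u.+1) * (1 - 'X) ^+ v.+1 * g.
Proof.
move=> F0 F1.
have cop : coprimep (('X - 0%:P) ^+ u.+1 : {poly R}) (('X - 1%:P) ^+ v.+1).
  apply/coprimep_expl/coprimep_expr/coprimep_XsubC2.
  by rewrite subr0 oner_eq0.
have : ('X - 0%:P) ^+ u.+1 * ('X - 1%:P) ^+ v.+1 %| F by rewrite Gauss_dvdp // F0.
(* The sign accounts for passing from powers of ['X - 1] to powers of [1 - 'X]. *)
case/dvdpP => g ->; exists ((-1) ^+ v.+1 * g).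
rewrite subr0 -[1 - 'X]opprB polyC1 [(- ('X - 1)) ^+ _]exprNn; move: ('X - 1) => y.
have := sqrr_sign {poly R} v.+1; move: ((-1) ^+ v.+1) => s ss.
transitivity (s ^+ 2 * (g * ('X^(u.+1) * y ^+ v.+1))); last by ring.
by rewrite ss mul1r.
Qed.

End RationalDerivatives.

(** * Bernstein and Jacobi polynomials *)

Section BernsteinPolynomials.
Variable R : realType.
Implicit Types (p q : {poly R}) (t : R).

Definition bernp n i : {poly R} := 'C(n, i)%:R *: ('X^i * (1 - 'X) ^+ (n - i)).

Lemma horner_bernp n i t : (bernp n i).[t] = bernstein n i t.
Proof.
rewrite /bernp /bernstein hornerZ hornerM hornerXn horner_exp hornerD hornerN.
by rewrite hornerX hornerC mulrA.
Qed.

Lemma poly_int_bernp n i : (i <= n)%N -> poly_int (bernp n i) = n.+1%:R^-1.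
Proof.
move=> le_in; rewrite poly_intZ poly_int_beta subnKC // invfM mulrCA mulfV ?mulr1 //.
by rewrite pnatr_eq0 -lt0n bin_gt0.
Qed.

Lemma bernpM k n j l : (j <= k)%N -> (l <= n)%N ->
  bernp k j * bernp n l =
  ('C(k, j)%:R * 'C(n, l)%:R / 'C(n + k, j + l)%:R) *: bernp (n + k) (j + l).
Proof.
move=> jk ln; have C0 : 'C(n + k, j + l)%:R != 0 :> R.
  by rewrite pnatr_eq0 -lt0n bin_gt0 addnC leq_add.
rewrite /bernp [RHS]scalerA divfK // -scalerAl -scalerAr scalerA; congr (_ *: _).
rewrite mulrACA -!exprD; congr (_ * _ ^+ _).
lia.
Qed.

(** Regrouping by [i = j + l]: the constraints [j <= k] and [l <= n] become the bounds on [j], where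
    truncated subtraction supplies the maximum with 0. *)
Lemma sum_convolution (V : nmodType) (F : nat -> nat -> V) k n :
  \sum_(j < k.+1) \sum_(l < n.+1) F j l =
  \sum_(0 <= i < (n + k).+1) \sum_(i - n <= j < (minn k i).+1) F j (i - j)%N.
Proof.
transitivity (\sum_(0 <= j < k.+1)
    \sum_(0 <= i < (n + k).+1 | (j <= i < n.+1 + j)%N) F j (i - j)%N).
  rewrite [RHS]big_mkord; apply: eq_bigr => j _.
  have jk : (j <= k)%N by rewrite -ltnS.
  transitivity (\sum_(0 + j <= i < n.+1 + j) F j (i - j)%N).
    rewrite big_addn addnK big_mkord; apply: eq_bigr => l _; by rewrite addnK.
  have h : (n.+1 + j <= (n + k).+1)%N by rewrite addSn ltnS leq_add2l.
  rewrite add0n (big_nat_widen _ _ _ _ _ h) (big_nat_widenl j 0) //.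
  by apply: eq_bigl => i; rewrite /= andbC.
rewrite (exchange_big_dep_nat xpredT) //=; apply: eq_big_nat => i /andP[_ hi].
have h : ((minn k i).+1 <= k.+1)%N by rewrite ltnS geq_minl.
rewrite [RHS](big_nat_widen _ _ _ _ _ h) [RHS](big_nat_widenl (i - n) 0) //.
rewrite big_nat_cond [RHS]big_nat_cond; apply: eq_bigl => j /=.
by apply/idP/idP; lia.
Qed.

(** The common source of the coefficients [Dcoef] and [Cpoint] and of the double sums on the
    right-hand side of the system. *)
Lemma bernstein_product k n (a b : nat -> R) :
  (\sum_(j < k.+1) a j *: bernp k j) * (\sum_(l < n.+1) b l *: bernp n l) =
  \sum_(0 <= i < (n + k).+1)
    (\sum_(i - n <= j < (minn k i).+1)
       'C(k, j)%:R * 'C(n, i - j)%:R / 'C(n + k, i)%:R * a j * b (i - j)%N)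
    *: bernp (n + k) i.
Proof.
rewrite big_distrlr /=.
rewrite (sum_convolution (fun j l => a j *: bernp k j * (b l *: bernp n l))).
apply: eq_big_nat => i /andP[_ hi]; rewrite scaler_suml.
apply: eq_big_nat => j /andP[hj1 hj2].
rewrite -scalerAl -scalerAr !scalerA bernpM ?scalerA; try lia.
by rewrite subnKC; [congr (_ *: _); ring | lia].
Qed.

Lemma poly_int_bernstein_sum N (c : nat -> R) :
  poly_int (\sum_(0 <= i < N.+1) c i *: bernp N i) =
  N.+1%:R^-1 * \sum_(0 <= i < N.+1) c i.
Proof.
rewrite linear_sum mulr_sumr; apply: eq_big_nat => i /andP[_ hi].
by rewrite linearZ /= poly_int_bernp // mulrC.
Qed.

Definition jacp u v k : {poly R} := \sum_(i < k.+1) Acoef R u v k i *: bernp k i.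

Lemma horner_jacp u v k t : (jacp u v k).[t] = jacobi u.+1 v.+1 k (2 * t - 1).
Proof.
rewrite jacobi_bernstein horner_sum; apply: eq_bigr => i _.
by rewrite hornerZ horner_bernp.
Qed.

Lemma jacpE u v k :
  jacp u v k = \sum_(i < k.+1)
    ((-1) ^+ (k + i) * 'C(k + u + 1, i)%:R * 'C(k + v + 1, k - i)%:R)
      *: ('X^i * (1 - 'X) ^+ (k - i)).
Proof.
apply: eq_bigr => i _; rewrite /bernp /Acoef scalerA divfK ?mulrA //.
by rewrite pnatr_eq0 -lt0n bin_gt0 -ltnS.
Qed.

(** Replacing [1 - 'X] by ['X - 1] cancels all signs. The coefficients become nonnegative and the
    polynomials monic of degree [k], so no cancellation can occur in the leading coefficient. *)
Lemma jacp_monic_sum u v k :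
  jacp u v k = \sum_(i < k.+1)
    ('C(k + u + 1, i)%:R * 'C(k + v + 1, k - i)%:R)
      *: ('X^i * ('X - 1%:P) ^+ (k - i)).
Proof.
rewrite jacpE; apply: eq_bigr => i _; have ik : (i <= k)%N by rewrite -ltnS.
have -> : (1 - 'X : {poly R}) ^+ (k - i) = (-1) ^+ (k - i) *: ('X - 1%:P) ^+ (k - i).
  by rewrite -exprZn scaleN1r opprB polyC1.
have ss : (-1) ^+ (k + i) * (-1) ^+ (k - i) = 1 :> R.
  have e : (k + i + (k - i) = 2 * k)%N by lia.
  by rewrite -exprD e exprM sqrrN !expr1n.
by rewrite -scalerAr scalerA mulrC !mulrA [X in X * _ * _]mulrC ss mul1r.
Qed.

Lemma size_monic_term i k : (i <= k)%N ->
  size ('X^i * ('X - 1%:P) ^+ (k - i) : {poly R}) = k.+1.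
Proof.
move=> ik; rewrite size_Mmonic ?monic_exp ?monicXsubC ?monic_neq0 ?monicXn //.
by rewrite size_polyXn size_exp_XsubC; lia.
Qed.

Lemma size_jacp u v k : (size (jacp u v k) <= k.+1)%N.
Proof.
rewrite jacp_monic_sum; apply: (leq_trans (size_sum _ _ _)).
apply/bigmax_leqP => i _; apply: (leq_trans (size_scale_leq _ _)).
by rewrite size_monic_term // -ltnS.
Qed.

Lemma jacp_lead u v k : (jacp u v k)`_k != 0.
Proof.
rewrite jacp_monic_sum coef_sum.
under eq_bigr => i _.
  have ik : (i <= k)%N by rewrite -ltnS.
  rewrite coefZ; have -> : ('X^i * ('X - 1%:P) ^+ (k - i) : {poly R})`_k = 1.
    have : 'X^i * ('X - 1%:P) ^+ (k - i) \is @monic R.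
      by rewrite monicMr ?monicXn ?monic_exp ?monicXsubC.
    by rewrite monicE lead_coefE size_monic_term //= => /eqP.
  rewrite mulr1; over.
rewrite psumr_neq0; last by move=> i _; rewrite mulr_ge0.
(* The term of index 0 is ['C(k + v + 1, k)], which is positive. *)
apply/hasP; exists ord0; first by rewrite mem_index_enum.
by rewrite /= bin0 mul1r subn0 ltr0n bin_gt0; lia.
Qed.

(** At the largest index [i] with [x i] nonzero, the coefficient of degree [i] of the sum comes from
    [f i] alone. *)
Lemma staircase_free M (f : nat -> {poly R}) (x : 'I_M.+1 -> R) :
  (forall k, (size (f k) <= k.+1)%N) -> (forall k, (f k)`_k != 0) ->
  \sum_(j < M.+1) x j *: f j = 0 -> forall j, x j = 0.
Proof.
move=> fs fl s0 j; apply/eqP/negPn/negP => xj.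
have [i xi imax] := @arg_maxnP _ j (fun i => x i != 0) (fun i => nat_of_ord i) xj.
have := congr1 (fun p : {poly R} => p`_i) s0; rewrite coef0 coef_sum (bigD1 i) //=.
rewrite big1 => [|l li]; last first.
  rewrite coefZ; have [li'|li'] := ltnP l i.
    by rewrite [_`_i]nth_default ?mulr0 // (leq_trans (fs l)).
  have [->|xl] := eqVneq (x l) 0; first by rewrite mul0r.
  have il : (l <= i)%N := imax l xl.
  by move: li; rewrite -val_eqE /=; lia.
by rewrite addr0 coefZ => /eqP; rewrite mulf_eq0 (negbTE xi) (negbTE (fl i)).
Qed.

End BernsteinPolynomials.

(** * Polynomial weighted least squares *)

Section WeightedLeastSquares.
Variables (R : realType) (d M : nat) (wt W : {poly R}) (J : nat -> {poly R}).
Variable g : 'I_d -> {poly R}.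
Hypothesis wt_ge0 : forall t, 0 <= t <= 1 -> 0 <= wt.[t].
Hypothesis W_ge0 : forall t, 0 <= t <= 1 -> 0 <= W.[t].
Hypothesis wtW_neq0 : wt * W != 0.
Hypothesis size_J : forall k, (size (J k) <= k.+1)%N.
Hypothesis lead_J : forall k, (J k)`_k != 0.
Implicit Types (x y : 'I_M.+1 -> 'rV[R]_d) (c : 'I_d).

Definition comb x c : {poly R} := \sum_(j < M.+1) x j ord0 c *: J j.

Definition energy x : R :=
  poly_int (wt * \sum_c (W * comb x c ^+ 2 - 2%:R *: (g c * comb x c))).

Definition normal_eqs x : Prop :=
  forall (k : 'I_M.+1) c, poly_int (wt * J k * (W * comb x c - g c)) = 0.

(** Along the line [x + e y] the energy is a quadratic polynomial in [e]: [quad y] is its leading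
    coefficient and [slope x y] half of its linear one. *)
Let quad y := poly_int (wt * \sum_c (W * comb y c ^+ 2)).
Let slope x y := poly_int (wt * \sum_c (comb y c * (W * comb x c - g c))).

Lemma combDZ x y e c :
  comb (fun j => x j + e *: y j) c = comb x c + e *: comb y c.
Proof.
rewrite /comb scaler_sumr -big_split; apply: eq_bigr => j _ /=.
by rewrite !mxE scalerDl scalerA.
Qed.

Lemma energyDZ x y e :
  energy (fun j => x j + e *: y j) = energy x + e ^+ 2 * quad y + 2%:R * e * slope x y.
Proof.
rewrite /energy /quad /slope -!poly_intZ -!linearD; congr poly_int.
rewrite !scalerAr -!mulrDr; congr (_ * _).
rewrite !scaler_sumr -!big_split; apply: eq_bigr => c _ /=.
by rewrite combDZ -!mul_polyC !polyCM !polyC_natr; ring.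
Qed.

Lemma quad_ge0 y : 0 <= quad y.
Proof.
apply: poly_int_ge0 => t t01; rewrite hornerM mulr_ge0 ?wt_ge0 // horner_sum sumr_ge0 //.
by move=> c _; rewrite hornerM mulr_ge0 ?W_ge0 // horner_exp sqr_ge0.
Qed.

Lemma slope_normal x y : normal_eqs x -> slope x y = 0.
Proof.
move=> nx; rewrite /slope mulr_sumr linear_sum big1 // => c _.
rewrite {1}/comb mulr_suml mulr_sumr linear_sum big1 // => k _.
by rewrite -scalerAl -scalerAr /= poly_intZ mulrA nx mulr0.
Qed.

Lemma energy_min_normal x :
  (forall x', energy x <= energy x') <-> normal_eqs x.
Proof.
split=> [minx k c|nx x']; last first.
  have -> : x' = fun j => x j + 1 *: (x' j - x j).
    by apply/funext => j; rewrite scale1r addrC subrK.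
  by rewrite energyDZ slope_normal // mulr0 addr0 expr1n mul1r lerDl quad_ge0.
(* Varying only coordinate [c] of the [k]-th coefficient turns the slope into the left side of the
   normal equation for [k] and [c]. *)
pose y (j : 'I_M.+1) : 'rV[R]_d := (j == k)%:R *: delta_mx ord0 c.
have yE c' : comb y c' = (c' == c)%:R *: J k.
  rewrite /comb (bigD1 k) //= big1 => [|j /negbTE jk]; last first.
    by rewrite /y jk scale0r mxE scale0r.
  by rewrite /y eqxx scale1r mxE eqxx addr0.
have -> : wt * J k * (W * comb x c - g c) =
          wt * \sum_c' (comb y c' * (W * comb x c' - g c')).
  rewrite (bigD1 c) //= big1 => [|c' /negbTE cc]; last by rewrite yE cc scale0r mul0r.
  by rewrite yE eqxx scale1r addr0 mulrA.
rewrite -/(slope x y); set L := slope x y; have Q0 := quad_ge0 y; set Q := quad y in Q0.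
have Q1 : 0 < Q + 1 by rewrite ltr_wpDl.
(* A descent step with the positive denominator [Q + 1]. It changes the energy by
   [- L^2 (Q + 2) / (Q + 1)^2], so minimality forces [L = 0]. *)
have := minx (fun j => x j + (- L / (Q + 1)) *: y j).
rewrite energyDZ -addrA lerDl -/L -/Q.
have -> : (- L / (Q + 1)) ^+ 2 * Q + 2%:R * (- L / (Q + 1)) * L =
          - (L ^+ 2 * ((Q + 2%:R) / (Q + 1) ^+ 2)).
  by field; rewrite gt_eqF.
rewrite oppr_ge0 pmulr_lle0 ?divr_gt0 ?exprn_gt0 ?ltr_wpDl //.
by move=> L2; apply/eqP; rewrite -sqrf_eq0 eq_le L2 sqr_ge0.
Qed.

Lemma poly_int_comb k x c :
  poly_int (wt * J k * (W * comb x c)) =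
  \sum_(j < M.+1) poly_int (wt * J k * (W * J j)) * x j ord0 c.
Proof.
rewrite /comb !mulr_sumr linear_sum; apply: eq_bigr => j _.
by rewrite -!scalerAr /= poly_intZ mulrC.
Qed.

Let gram : 'M[R]_M.+1 := \matrix_(k, j) poly_int (wt * J k * (W * J j)).

(** A row vector annihilated by the Gram matrix gives a combination [p] of the [J k] with
    [wt * W * p ^+ 2] of integral 0. This polynomial is nonnegative on the interval, so [p = 0], and
    the [J k] are linearly independent. *)
Lemma gram_unit : gram \in unitmx.
Proof.
rewrite -row_free_unit; apply: inj_row_free => v vG.
have [p pE] : exists p, p = \sum_(k < M.+1) v ord0 k *: J k by eexists.
have pJ (j : 'I_M.+1) : poly_int (wt * p * (W * J j)) = 0.
  have := congr1 (fun A : 'rV_M.+1 => A ord0 j) vG; rewrite !mxE => <-.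
  rewrite pE mulr_sumr mulr_suml linear_sum; apply: eq_bigr => k _.
  by rewrite mxE -scalerAr -scalerAl /= poly_intZ.
have pp : poly_int (wt * p * (W * p)) = 0.
  rewrite [X in W * X]pE !mulr_sumr linear_sum big1 // => j _.
  by rewrite -!scalerAr /= poly_intZ pJ mulr0.
have p0 : p = 0.
  have : wt * p * (W * p) = 0.
    apply: poly_int_eq0 pp => t t01; rewrite !hornerM mulrACA.
    by rewrite mulr_ge0 ?(mulr_ge0 (wt_ge0 _) (W_ge0 _)) // -expr2 sqr_ge0.
  by rewrite mulrACA => /eqP; rewrite mulf_eq0 (negbTE wtW_neq0) -expr2 sqrf_eq0 => /eqP.
apply/rowP => j; rewrite mxE.
exact: (staircase_free (x := fun k => v ord0 k) size_J lead_J (etrans (esym pE) p0)).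
Qed.

(** The coordinates decouple: each is a column of the unknown, and all share the same matrix. *)
Lemma normal_eqs_gram x :
  normal_eqs x <->
  gram *m (\matrix_(j, c) x j ord0 c) = \matrix_(k, c) poly_int (wt * J k * g c).
Proof.
have E (k : 'I_M.+1) c : poly_int (wt * J k * (W * comb x c - g c)) =
    (gram *m (\matrix_(j, c) x j ord0 c)) k c - poly_int (wt * J k * g c).
  rewrite mulrBr linearB /= mxE poly_int_comb; congr (_ - _).
  by apply: eq_bigr => j _; rewrite !mxE.
split=> [nx|GX k c]; last by rewrite E GX mxE subrr.
by apply/matrixP => k c; apply/eqP; rewrite [X in _ == X]mxE -subr_eq0 -E nx.
Qed.

Lemma normal_eqs_unique : exists! x, normal_eqs x.
Proof.
pose X := invmx gram *m \matrix_(k, c) poly_int (wt * J k * g c).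
exists (fun j => row j X); split=> [|x /normal_eqs_gram GX].
  apply/normal_eqs_gram; rewrite -[RHS](mulKVmx gram_unit); congr (_ *m _).
  by apply/matrixP => j c; rewrite !mxE.
apply/funext => j; apply/rowP => c; rewrite /X -GX mulKmx ?gram_unit //.
by rewrite !mxE.
Qed.

End WeightedLeastSquares.

(** * Reduction of the error functional *)

(* For [w.[t] = 0] both sides are 0, since then [w.[t]^-1 = 0]. *)
Lemma weighted_residual (R : realType) d (w W : {poly R})
    (X Y g S : 'I_d -> {poly R}) t :
  (forall c, X c - W * Y c = w * g c) -> W.[t] != 0 ->
  W.[t] / w.[t] * \sum_c ((X c).[t] / W.[t] - (Y c + w * S c).[t]) ^+ 2 =
  (w * \sum_c g c ^+ 2).[t] / W.[t] +
  (w * \sum_c (W * S c ^+ 2 - 2%:R *: (g c * S c))).[t].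
Proof.
move=> XE W0; rewrite !hornerM !horner_sum -[in RHS]mulrA -mulrDr.
rewrite mulr_suml -big_split /= mulr_sumr [RHS]mulr_sumr; apply: eq_bigr => c _.
have := congr1 (fun P : {poly R} => P.[t]) (XE c).
rewrite /= !(hornerD, hornerN, hornerM, hornerZ, horner_exp) => /eqP.
rewrite subr_eq => /eqP ->.
have [->|w0] := eqVneq w.[t] 0; first by rewrite invr0 mulr0 !mul0r.
by field; rewrite W0 w0.
Qed.

Section Reduction.
Variables (R : realType) (n m u v d : nat).
Variables (p : nat -> 'rV[R]_d) (omega : nat -> R) (q : nat -> 'rV[R]_d).
Hypothesis huv : (u + v < m - 1)%N.
Hypothesis homega : forall i : nat, (i <= n)%N -> 0 < omega i.
Implicit Types (t : R) (c : 'I_d).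

Definition endpointp : {poly R} := 'X^(u.+1) * (1 - 'X) ^+ v.+1.

Definition weightp : {poly R} := \sum_(i < n.+1) omega i *: bernp R n i.

Definition numeratorp c : {poly R} :=
  \sum_(i < n.+1) (omega i *: p i) ord0 c *: bernp R n i.

(** The fixed part of the approximating curve. Padding with zero points makes it a Bernstein sum
    over the full index range, ready for [bernstein_product]. *)
Definition boundaryp c : {poly R} :=
  \sum_(j < m.+1) Qpoint u v m q j ord0 c *: bernp R m j.

Lemma horner_endpointp t : endpointp.[t] = t ^+ u.+1 * (1 - t) ^+ v.+1.
Proof. by rewrite hornerM hornerXn horner_exp hornerD hornerN hornerX hornerC. Qed.

Lemma horner_weightp t : weightp.[t] = weight n omega t.
Proof. by rewrite horner_sum; apply: eq_bigr => i _; rewrite hornerZ horner_bernp. Qed.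

Lemma rat_curveE t :
  rat_curve n omega p t = \row_c ((numeratorp c).[t] / weightp.[t]).
Proof.
apply/rowP => c; rewrite !mxE mulrC horner_weightp; congr (_ / _).
rewrite summxE horner_sum; apply: eq_bigr => i _.
by rewrite hornerZ horner_bernp !mxE mulrC.
Qed.

(** By [huv] the two ranges of fixed indices are disjoint, and the padded points vanish between
    them. *)
Lemma sum_boundary (F : nat -> {poly R}) c :
  \sum_(j < m.+1) Qpoint u v m q j ord0 c *: F j =
  \sum_(0 <= j < u.+1) q j ord0 c *: F j
  + \sum_(m - v <= j < m.+1) q j ord0 c *: F j.
Proof.
have h1 : (u.+1 <= m - v)%N by lia.
have h2 : (m - v <= m.+1)%N by lia.
rewrite -(big_mkord xpredT (fun j => Qpoint u v m q j ord0 c *: F j)).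
rewrite (big_cat_nat (leq0n _) (leq_trans h1 h2)) (big_cat_nat h1 h2) /=.
rewrite [X in _ + (X + _)]big1_seq ?add0r; last first.
  move=> j /andP[_]; rewrite mem_index_iota => hj.
  by rewrite /Qpoint ifF ?mxE ?scale0r //; lia.
congr (_ + _); apply: eq_big_nat => j hj; rewrite /Qpoint ifT //; lia.
Qed.

Lemma poly_curveE M (qt : 'I_M.+1 -> 'rV[R]_d) t :
  poly_curve m u v q qt t =
  \row_c (boundaryp c + endpointp * comb (jacp R u v) qt c).[t].
Proof.
apply/rowP => c; rewrite !mxE hornerD hornerM horner_endpointp /boundaryp.
rewrite sum_boundary hornerD !horner_sum !summxE addrAC; congr (_ + _ + _).
- by apply: eq_bigr => j _; rewrite hornerZ horner_bernp !mxE mulrC.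
- by apply: eq_bigr => j _; rewrite hornerZ horner_bernp !mxE mulrC.
- congr (_ * _); apply: eq_bigr => j _.
  by rewrite hornerZ horner_jacp !mxE mulrC.
Qed.

Lemma weightp_gt0 t : 0 <= t <= 1 -> 0 < weightp.[t].
Proof.
move=> /andP[t0 t1]; rewrite horner_weightp.
have b0 i : 0 <= bernstein n i t.
  by rewrite /bernstein !mulr_ge0 ?exprn_ge0 ?subr_ge0.
have nn (i : 'I_n.+1) : 0 <= omega i * bernstein n i t.
  by rewrite mulr_ge0 // ltW // homega // -ltnS.
(* The first basis function is positive for [t < 1], the last one at [t = 1]. *)
have [i bi] : exists i : 'I_n.+1, 0 < bernstein n i t.
  have [t1'|t1'] := ltP t 1.
    by exists ord0; rewrite /bernstein bin0 !mul1r exprn_gt0 // subr_gt0.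
  have -> : t = 1 by apply: le_anti; rewrite t1.
  by exists ord_max; rewrite /bernstein /= binn subnn expr1n !mulr1.
rewrite /weight (bigD1 i) //=; apply: ltr_pwDl; last exact: sumr_ge0.
by rewrite mulr_gt0 // homega // -ltnS.
Qed.

Lemma endpointp_ge0 t : 0 <= t <= 1 -> 0 <= endpointp.[t].
Proof.
by move=> /andP[t0 t1]; rewrite horner_endpointp mulr_ge0 ?exprn_ge0 ?subr_ge0.
Qed.

Lemma endpointp_weightp_neq0 : endpointp * weightp != 0.
Proof.
apply/eqP => /(congr1 (fun P : {poly R} => P.[2^-1])); rewrite /= horner0 hornerM.
have h : 0 <= (2^-1 : R) <= 1 by lra.
move/eqP; rewrite mulf_eq0 [_ || _]orbC gt_eqF ?weightp_gt0 //= horner_endpointp.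
have -> : 1 - 2^-1 = 2^-1 :> R by lra.
by rewrite mulf_eq0 !expf_eq0 /= invr_eq0 pnatr_eq0.
Qed.

Lemma Cuv_endpoint_factor M (qt : 'I_M.+1 -> 'rV[R]_d) :
  Cuv_continuity u v (rat_curve n omega p) (poly_curve m u v q qt) ->
  exists g : 'I_d -> {poly R},
    forall c, numeratorp c - weightp * boundaryp c = endpointp * g c.
Proof.
move=> [C0 C1]; pose Y c := boundaryp c + endpointp * comb (jacp R u v) qt c.
have xE t : weightp.[t] != 0 ->
    rat_curve n omega p t = \row_c ((numeratorp c).[t] / weightp.[t]).
  by move=> _; exact: rat_curveE.
(* The polynomial curve is written over the denominator [weightp] too, so that equal derivatives of
   the two curves mean equal numerators. *)
have yE t : weightp.[t] != 0 ->
    poly_curve m u v q qt t = \row_c ((Y c * weightp).[t] / weightp.[t]).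
  by move=> Wt; rewrite poly_curveE; apply/rowP => c; rewrite !mxE hornerM mulfK.
have vanish a r : weightp.[a] != 0 ->
    derive1n r (rat_curve n omega p) a = derive1n r (poly_curve m u v q qt) a ->
    forall c, (ratio_deriv weightp (numeratorp c - Y c * weightp) r).[a] = 0.
  move=> Wa; rewrite (derive1n_ratio xE r Wa) (derive1n_ratio yE r Wa) => E c.
  have /rowP/(_ c) := E; rewrite !mxE => /(mulIf _) E'.
  by rewrite ratio_derivB hornerD hornerN E' ?subrr // invr_neq0 // expf_neq0.
have W0 : weightp.[0] != 0 by rewrite gt_eqF // weightp_gt0 // lexx ler01.
have W1 : weightp.[1] != 0 by rewrite gt_eqF // weightp_gt0 // lexx ler01.
have fac c : exists g, numeratorp c - weightp * boundaryp c = endpointp * g.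
  have [||g gE] := @endpoint_dvdp R (numeratorp c - Y c * weightp) u v.
  - by apply: (ratio_deriv_dvdp W0) => r ru; exact: (vanish 0 r W0 (C0 r ru)).
  - by apply: (ratio_deriv_dvdp W1) => r ru; exact: (vanish 1 r W1 (C1 r ru)).
  (* The part of the curve built from [qt] already carries the endpoint factor and is moved into the
     quotient. *)
  exists (g + comb (jacp R u v) qt c * weightp).
  rewrite mulrDr -gE /Y -/endpointp; ring.
by have [g gE] := fin_all_exists fac; exists g.
Qed.

Lemma integrable_poly_ratio (P : {poly R}) :
  (@lebesgue_measure R).-integrable `[0%R, 1%R]%classic
    (EFin \o (fun t => P.[t] / weightp.[t])).
Proof.
apply: continuous_compact_integrable; first exact: segment_compact.
apply: continuous_in_subspaceT => t; rewrite inE /= in_itv /= => t01.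
apply: cvgM; first exact: continuous_horner.
apply: cvgV; last exact: continuous_horner.
by rewrite gt_eqF // weightp_gt0.
Qed.

Lemma integrable_poly (P : {poly R}) :
  (@lebesgue_measure R).-integrable `[0%R, 1%R]%classic (EFin \o horner P).
Proof.
apply: continuous_compact_integrable; first exact: segment_compact.
by apply: continuous_subspaceT; exact: continuous_horner.
Qed.

Section Energy.
Variable g : 'I_d -> {poly R}.
Hypothesis gE : forall c, numeratorp c - weightp * boundaryp c = endpointp * g c.

Lemma enormE (w : 'rV[R]_d) : enorm w ^+ 2 = \sum_c w ord0 c ^+ 2.
Proof. by rewrite sqr_sqrtr // sumr_ge0 // => c _; exact: sqr_ge0. Qed.

Lemma weighted_integrandE M (qt : 'I_M.+1 -> 'rV[R]_d) t : 0 <= t <= 1 ->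
  weight n omega t / (t ^+ u.+1 * (1 - t) ^+ v.+1)
    * enorm (rat_curve n omega p t - poly_curve m u v q qt t) ^+ 2 =
  (endpointp * \sum_c g c ^+ 2).[t] / weightp.[t] +
  (endpointp * \sum_c (weightp * comb (jacp R u v) qt c ^+ 2
                       - 2%:R *: (g c * comb (jacp R u v) qt c))).[t].
Proof.
move=> t01; have W0 : weightp.[t] != 0 by rewrite gt_eqF // weightp_gt0.
rewrite enormE rat_curveE poly_curveE -horner_weightp -horner_endpointp.
rewrite -(weighted_residual _ gE W0); congr (_ * _).
by apply: eq_bigr => c _; rewrite !mxE.
Qed.

Lemma weighted_errorE : exists K : R, forall M (qt : 'I_M.+1 -> 'rV[R]_d),
  weighted_error n m u v omega p q qt =
  (K + energy endpointp weightp (jacp R u v) g qt)%:E.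
Proof.
pose P := endpointp * \sum_c g c ^+ 2.
have iP := integrable_poly_ratio P.
(* This integral is finite because [weightp] has no zero on the interval, so it can be split off as
   a real constant independent of [qt]. *)
exists (fine (\int[@lebesgue_measure R]_(t in `[0%R, 1%R]%classic)
          (P.[t] / weightp.[t])%:E)) => M qt.
rewrite EFinD fineK; last exact: integrable_fin_num.
rewrite -integral_poly -integralD //; last exact: integrable_poly.
by apply: eq_integral => t; rewrite inE /= in_itv /= => t01; rewrite weighted_integrandE.
Qed.

End Energy.
End Reduction.

(** * Coefficients of the linear system *)

Section Coefficients.
Variables (R : realType) (u v : nat).

Lemma weightp_jacp n (omega : nat -> R) k :
  weightp n omega * jacp R u v k =
  \sum_(0 <= i < (n + k).+1) Dcoef u v n omega k i *: bernp R (n + k) i.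
Proof.
rewrite mulrC bernstein_product; apply: eq_bigr => i _; congr (_ *: _).
by apply: eq_bigr => j _; rewrite mulrAC.
Qed.

Lemma weightp_boundaryp n m d (omega : nat -> R) (q : nat -> 'rV[R]_d) c :
  weightp n omega * boundaryp m u v q c =
  \sum_(l < (m + n).+1) Cpoint u v n m omega q l ord0 c *: bernp R (m + n) l.
Proof.
rewrite mulrC /boundaryp (bernstein_product _ _ (fun j => Qpoint u v m q j ord0 c)).
rewrite addnC big_mkord; apply: eq_bigr => i _; congr (_ *: _).
rewrite /Cpoint summxE; by apply: eq_bigr => j _; rewrite mxE mulrAC.
Qed.

Lemma poly_int_gram n (omega : nat -> R) k j :
  \sum_(0 <= i < (n + k).+1) \sum_(0 <= l < j.+1)
     ((-1) ^+ (j + l)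
      * 'C(n + k, i)%:R * 'C(j + u + 1, l)%:R * 'C(j + v + 1, j - l)%:R
      / ((u + v + n + k + j + 3)%:R
         * 'C(u + v + n + k + j + 2, u + l + i + 1)%:R)
      * Dcoef u v n omega k i) =
  poly_int (endpointp R u v * jacp R u v k * (weightp n omega * jacp R u v j)).
Proof.
(* The weight goes with the polynomial of index [k], whose product has Bernstein coefficients
   [Dcoef]; the endpoint factor goes with the one of index [j], expanded by [jacpE]. Each pair of
   terms is then one beta integral. *)
have -> : endpointp R u v * jacp R u v k * (weightp n omega * jacp R u v j) =
    (weightp n omega * jacp R u v k) * (endpointp R u v * jacp R u v j) by ring.
rewrite weightp_jacp jacpE mulr_sumr mulr_suml linear_sum.
apply: eq_big_nat => i /andP[_ hi]; rewrite mulr_sumr linear_sum big_mkord.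
apply: eq_bigr => l _; have hl : (l <= j)%N by rewrite -ltnS.
rewrite /bernp /endpointp -!(scalerAl, scalerAr) !scalerA /= poly_intZ.
have -> : 'X^i * (1 - 'X) ^+ (n + k - i) *
    ('X^(u.+1) * (1 - 'X) ^+ v.+1 * ('X^l * (1 - 'X) ^+ (j - l))) =
    'X^(u + l + i + 1) * (1 - 'X) ^+ (v + (n + k - i) + (j - l) + 1) :> {poly R}.
  by rewrite !exprD !exprS; ring.
rewrite poly_int_beta.
have -> : (u + l + i + 1 + (v + (n + k - i) + (j - l) + 1) = u + v + n + k + j + 2)%N.
  by lia.
have -> : ((u + v + n + k + j + 2).+1 = u + v + n + k + j + 3)%N by lia.
by rewrite /GRing.scale /=; ring.
Qed.

Lemma poly_int_jacp_sum N k (b : nat -> R) :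
  poly_int (jacp R u v k * \sum_(l < N.+1) b l *: bernp R N l) =
  (N + k).+1%:R^-1 * \sum_(0 <= i < (N + k).+1) \sum_(i - N <= j < (minn k i).+1)
    'C(k, j)%:R * 'C(N, i - j)%:R / 'C(N + k, i)%:R * Acoef R u v k j * b (i - j)%N.
Proof. by rewrite bernstein_product poly_int_bernstein_sum. Qed.

Lemma system_lhsE n d M (omega : nat -> R) (qt : 'I_M.+1 -> 'rV[R]_d) k c :
  (\sum_(j < M.+1)
    (\sum_(0 <= i < (n + k).+1) \sum_(0 <= l < j.+1)
       ((-1) ^+ (j + l)
        * 'C(n + k, i)%:R * 'C(j + u + 1, l)%:R * 'C(j + v + 1, j - l)%:R
        / ((u + v + n + k + j + 3)%:R
           * 'C(u + v + n + k + j + 2, u + l + i + 1)%:R)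
        * Dcoef u v n omega k i)) *: qt j) ord0 c =
  poly_int (endpointp R u v * jacp R u v k
            * (weightp n omega * comb (jacp R u v) qt c)).
Proof.
rewrite summxE poly_int_comb; apply: eq_bigr => j _.
by rewrite mxE poly_int_gram.
Qed.

(** The two products with [jacp] are Bernstein sums of degrees [n + k] and [m + n + k]; since all
    basis functions of one degree have the same integral, each contributes the mean of its
    coefficients. *)
Lemma system_rhsE n m d (omega : nat -> R) (p q : nat -> 'rV[R]_d) k c :
  ((n + k + 1)%:R^-1 *:
     (\sum_(0 <= i < (n + k).+1)
        \sum_(i - n <= j < (minn k i).+1)
          ('C(k, j)%:R * 'C(n, i - j)%:R / 'C(n + k, i)%:R
           * Acoef R u v k j) *: (omega (i - j)%N *: p (i - j)%N))
   - (m + n + k + 1)%:R^-1 *: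
     (\sum_(0 <= i < (m + n + k).+1)
        \sum_(i - (m + n) <= j < (minn k i).+1)
          ('C(k, j)%:R * 'C(m + n, i - j)%:R / 'C(m + n + k, i)%:R
           * Acoef R u v k j) *: Cpoint u v n m omega q (i - j))) ord0 c =
  poly_int (jacp R u v k
            * (numeratorp n p omega c - weightp n omega * boundaryp m u v q c)).
Proof.
rewrite mulrBr linearB /= weightp_boundaryp.
rewrite (poly_int_jacp_sum _ _ (fun i => (omega i *: p i) ord0 c)).
rewrite (poly_int_jacp_sum _ _ (fun i => Cpoint u v n m omega q i ord0 c)).
rewrite !mxE !summxE !addn1; congr (_ * _ - _ * _); apply: eq_bigr => i _;
  by rewrite summxE; apply: eq_bigr => j _; rewrite !mxE.
Qed.

End Coefficients.

(** * The linear system as the normal equations of the approximation problem *)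

Theorem mainTheorem2 (R : realType) (n m u v d M : nat)
    (hd : (1 <= d)%N)
    (huv : (u + v < m - 1)%N)
    (hM : M = (m - (u + v + 2))%N)
    (p : nat -> 'rV[R]_d)
    (omega : nat -> R)
    (homega : forall i : nat, (i <= n)%N -> 0 < omega i)
    (q : nat -> 'rV[R]_d)
    (* the condition does not depend on the coefficients qt *)
    (hq : exists qt : 'I_M.+1 -> 'rV[R]_d,
        Cuv_continuity u v (rat_curve n omega p) (poly_curve m u v q qt)) :
  let minimizer (qt : 'I_M.+1 -> 'rV[R]_d) : Prop :=
    forall qt' : 'I_M.+1 -> 'rV[R]_d,
      (weighted_error n m u v omega p q qt <= weighted_error n m u v omega p q qt')%E in
  let solution (qt : 'I_M.+1 -> 'rV[R]_d) : Prop :=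
    forall k : nat, (k <= M)%N ->
      \sum_(j < M.+1)
        (\sum_(0 <= i < (n + k).+1) \sum_(0 <= l < j.+1)
           ((-1) ^+ (j + l)
            * 'C(n + k, i)%:R * 'C(j + u + 1, l)%:R * 'C(j + v + 1, j - l)%:R
            / ((u + v + n + k + j + 3)%:R
               * 'C(u + v + n + k + j + 2, u + l + i + 1)%:R)
            * Dcoef u v n omega k i)) *: qt j
      = (n + k + 1)%:R^-1 *:
          (\sum_(0 <= i < (n + k).+1)
             \sum_(i - n <= j < (minn k i).+1)
               ('C(k, j)%:R * 'C(n, i - j)%:R / 'C(n + k, i)%:R
                * Acoef R u v k j) *: (omega (i - j)%N *: p (i - j)%N))
        - (m + n + k + 1)%:R^-1 *:
          (\sum_(0 <= i < (m + n + k).+1)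
             \sum_(i - (m + n) <= j < (minn k i).+1)
               ('C(k, j)%:R * 'C(m + n, i - j)%:R / 'C(m + n + k, i)%:R
                * Acoef R u v k j) *: Cpoint u v n m omega q (i - j)) in
  (exists! qt : 'I_M.+1 -> 'rV[R]_d, solution qt) /\
  (forall qt : 'I_M.+1 -> 'rV[R]_d, minimizer qt <-> solution qt).
Proof.
move=> minimizer solution.
have [qt0 /(Cuv_endpoint_factor huv homega) [g gE]] := hq.
pose J := jacp R u v; pose w := endpointp R u v; pose W := weightp n omega.
have solE qt : solution qt <-> normal_eqs w W J g qt.
  (* The factorization [gE] replaces [w * g c] by the numerator minus [W] times the fixed part,
     whose Bernstein coefficients are explicit. *)
  have colE (k : nat) c : w * J k * (W * comb J qt c - g c) =
      w * J k * (W * comb J qt c)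
      - J k * (numeratorp n p omega c - W * boundaryp m u v q c).
    by rewrite gE mulrBr [w * J k * g c]mulrAC [w * g c * _]mulrC.
  split=> [sol k c|nx k kM].
    have := sol k (ltn_ord k) => /rowP/(_ c); rewrite system_lhsE system_rhsE.
    by rewrite colE linearB /= => ->; rewrite subrr.
  apply/rowP => c; rewrite system_lhsE system_rhsE; apply/eqP.
  rewrite -subr_eq0 -linearB /= -colE; apply/eqP.
  exact: (nx (@Ordinal M.+1 k kM) c).
have W_ge0 t : 0 <= t <= 1 -> 0 <= W.[t] by move=> /(weightp_gt0 homega)/ltW.
have [K KE] := weighted_errorE huv homega gE.
have minE (qt : 'I_M.+1 -> 'rV[R]_d) : minimizer qt <->
    forall qt' : 'I_M.+1 -> 'rV[R]_d, energy w W J g qt <= energy w W J g qt'.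
  by split=> H qt'; have := H qt'; rewrite !KE lee_fin lerD2l.
have [qt [nqt uqt]] := normal_eqs_unique M g (@endpointp_ge0 R u v) W_ge0
  (endpointp_weightp_neq0 u v homega) (size_jacp R u v) (jacp_lead R u v).
split.
  exists qt; split; first by apply/solE.
  by move=> qt' /solE; exact: uqt.
move=> qt'; rewrite minE solE.
by apply: energy_min_normal => //; exact: endpointp_ge0.
Qed.
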